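(* Let $K$ be an algebraic number field of degree $n$ with ring of integers $\mathbb{Z}_K$, let $p$ be a prime, let $\mathcal{O}$ be an order in $K$, and let $I$ be a full lattice in $K$ such that (a) $p \in I$; (b) $I^2 \subseteq I \subseteq J_p(\mathcal{O})$; (c) $I^r$ is an invertible ideal of $\mathcal{O}$ for some $1\le r<n$, where $r$ is taken minimal with this property. Then: (1) $I\mathcal{O}$ is an invertible ideal of $\mathcal{O}$. (2) If $J_p(\mathcal{O})\mathbb{Z}_K = p\mathbb{Z}_K$, then $I \subseteq I\mathcal{O} = p\mathcal{O}$ and $I^r = p^r\mathcal{O}$. (3) If $p$ is unramified in $K$, then $J_p(\mathcal{O})\mathbb{Z}_K = p\mathbb{Z}_K$.
   Context: A full lattice in $K$ is a finitely generated $\mathbb{Z}$-submodule of $K$ containing a $\mathbb{Q}$-basis of $K$. An order in $K$ is a subring (with $1$) that is a full lattice. The product $IJ$ of full lattices is the $\mathbb{Z}$-module generated by the products $ij$, $i\in I$, $j\in J$; powers $I^r$ are defined accordingly. The $p$-radical $J_p(\mathcal{O})$ is the intersection of the prime ideals of $\mathcal{O}$ containing $p$. *)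

(* Defs.v *)
From HB Require Import structures.
From mathcomp Require Import all_boot all_order all_algebra all_field.
From mathcomp Require Import mathcomp_extra boolp classical_sets.

Set Implicit Arguments.
Unset Strict Implicit.
Unset Printing Implicit Defensive.

Import Order.TTheory GRing.Theory Num.Theory.
Local Open Scope ring_scope.
Local Open Scope classical_set_scope.

(* A number field is a [fieldExtType rat] (finite-dimensional over Q); orders,
   ideals and lattices are [set]s of its elements. *)

Definition ring_of_integers (K : fieldExtType rat) : set K :=
  [set x | integralOver (intr : int -> K) x].

Definition zsubmodule (K : fieldExtType rat) (A : set K) : Prop :=
  zmod_closed [in A].

Definition finitely_generated (K : fieldExtType rat) (A : set K) : Prop :=
  exists (m : nat) (s : m.-tuple K), A = [set x | inIntSpan s x].

Definition full_lattice (K : fieldExtType rat) (L : set K) : Prop :=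
  finitely_generated L /\
  exists2 b : seq K, basis_of {:K} b & [set` b] `<=` L.

Definition is_order (K : fieldExtType rat) (O : set K) : Prop :=
  full_lattice O /\ subring_closed [in O].

Definition lmul (K : fieldExtType rat) (A B : set K) : set K :=
  smallest (@zsubmodule K) [set a * b | a in A & b in B].

(* [lpow A 1] is [A], [lpow A r.+1] is [lmul A (lpow A r)] for [0 < r], and
   [lpow A 0] is the subring Z of K, the unit for the product of lattices. *)
Definition lpow (K : fieldExtType rat) (A : set K) (r : nat) : set K :=
  iterop r (@lmul K) A (range (intr : int -> K)).

Definition scale (K : fieldExtType rat) (c : K) (A : set K) : set K :=
  [set c * x | x in A].

Definition is_ideal (K : fieldExtType rat) (O A : set K) : Prop :=
  [/\ zsubmodule A, A `<=` O
    & forall x a, O x -> A a -> A (x * a)].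

Definition prime_ideal (K : fieldExtType rat) (O P : set K) : Prop :=
  [/\ is_ideal O P, P <> O
    & forall x y, O x -> O y -> P (x * y) -> P x \/ P y].

Definition fractional_ideal (K : fieldExtType rat) (O A : set K) : Prop :=
  full_lattice A /\ (forall x a, O x -> A a -> A (x * a)).

Definition invertible_ideal (K : fieldExtType rat) (O A : set K) : Prop :=
  is_ideal O A /\ exists2 B, fractional_ideal O B & lmul A B = O.

(* Intersecting with [O] only matters for an empty family of primes. *)
Definition p_radical (K : fieldExtType rat) (p : nat) (O : set K) : set K :=
  O `&` \bigcap_(P in [set P | prime_ideal O P /\ P p%:R]) P.

(* All exponents in the prime factorisation of p Z_K are 1, i.e. p Z_K is a
   product of pairwise distinct prime ideals. *)
Definition unramified (K : fieldExtType rat) (p : nat) : Prop :=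
  let ZK := @ring_of_integers K in
  exists (g : nat) (P : 'I_g -> set K),
    [/\ injective P, forall i, prime_ideal ZK (P i)
      & scale p%:R ZK = \big[@lmul K/ZK]_(i < g) P i].

(* Main.v *)
Require Import Defs.
From HB Require Import structures.
From mathcomp Require Import all_boot all_order all_algebra all_field.
From mathcomp Require Import mathcomp_extra boolp classical_sets.

Set Implicit Arguments.
Unset Strict Implicit.
Unset Printing Implicit Defensive.

Import Order.TTheory GRing.Theory Num.Theory.
Local Open Scope ring_scope.
Local Open Scope classical_set_scope.

(* Let J be the p-radical of O. As I^r is an O-module, (I O) I^(r-1) = I^r, so
   an inverse of I^r yields one of I O. If moreover J Z_K = p Z_K, then
   A = p^-1 I O is an invertible O-module of integral elements with 1 in A. The
   powers of A then stabilise, and cancelling gives A = O, whence I^r = (I O)^r =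
   p^r O. When p is unramified, the primes P_i of Z_K above p contract to primes
   of O above p, so J lies in their intersection, which equals their product
   p Z_K because distinct P_i are comaximal. *)

Local Notation "A ** B" := (lmul A B) (at level 40, left associativity).
Local Notation ZK := (@ring_of_integers _).
Local Notation zint := (range (intr : int -> _)).

(** * Submodules of [K] over Z: products, scaling, powers and finite spans *)

Section Lattices.
Variable K : fieldExtType rat.
Implicit Types (A B C D O P : set K) (x y c : K) (s t : seq K).

Lemma zsubmoduleP A :
  zsubmodule A <-> A 0 /\ forall x y, A x -> A y -> A (x - y).
Proof.
split=> [[A0 AB]|[A0 AB]].
  by split=> [|x y Ax Ay]; [|have := AB x y]; rewrite !in_setE in A0 *; auto.
by split=> [|x y]; rewrite !in_setE //; apply: AB.
Qed.

Lemma zsubmodule0 A : zsubmodule A -> A 0.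
Proof. by case/zsubmoduleP. Qed.

Lemma zsubmoduleB A x y : zsubmodule A -> A x -> A y -> A (x - y).
Proof. by case/zsubmoduleP=> _; apply. Qed.

Lemma zsubmoduleN A x : zsubmodule A -> A x -> A (- x).
Proof.
move=> zA Ax; rewrite -sub0r.
exact: zsubmoduleB zA (zsubmodule0 zA) Ax.
Qed.

Lemma zsubmoduleD A x y : zsubmodule A -> A x -> A y -> A (x + y).
Proof.
move=> zA Ax Ay; rewrite -[y]opprK.
by apply: zsubmoduleB => //; apply: zsubmoduleN.
Qed.

Lemma zsubmoduleMz A x (m : int) : zsubmodule A -> A x -> A (x *~ m).
Proof.
move=> zA Ax; have An n : A (x *+ n).
  by elim: n => [|n IH]; [apply: zsubmodule0 | rewrite mulrS; apply: zsubmoduleD].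
case: m => n; first by rewrite -pmulrn.
by rewrite NegzE mulrNz -pmulrn; apply: zsubmoduleN.
Qed.

Lemma zsubmodule_sum A (I : eqType) (r : seq I) (F : I -> K) :
  zsubmodule A -> (forall i, i \in r -> A (F i)) -> A (\sum_(i <- r) F i).
Proof.
move=> zA; elim: r => [|i r IH] AF; first by rewrite big_nil; apply: zsubmodule0.
rewrite big_cons; apply: zsubmoduleD => //; first by apply/AF/mem_head.
by apply: IH => j jr; apply: AF; rewrite inE jr orbT.
Qed.

(** Lets a property of the form [A (x * c)], with [c] fixed, be checked on generators only:
    [lmul_sub] and [zspan_sub] are applied to this preimage, one factor at a time. *)
Lemma zsubmodule_mulr_preim A c : zsubmodule A -> zsubmodule [set x | A (x * c)].
Proof.
move=> zA; apply/zsubmoduleP; split=> [|x y] /=; first by rewrite mul0r; apply: zsubmodule0.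
by rewrite mulrBl; apply: zsubmoduleB.
Qed.

Lemma zsubmodule_scale A c : zsubmodule A -> zsubmodule (scale c A).
Proof.
move=> zA; apply/zsubmoduleP; split; first by exists 0; [apply: zsubmodule0 | rewrite mulr0].
move=> _ _ [a Aa <-] [b Ab <-]; exists (a - b); last by rewrite mulrBr.
exact: zsubmoduleB.
Qed.

Lemma zsubmodule_smallest (G : set K) : zsubmodule (smallest (@zsubmodule K) G).
Proof.
apply/zsubmoduleP; split=> [M [zM _]|x y Gx Gy M [zM GM]]; first exact: zsubmodule0.
by apply: zsubmoduleB => //; [apply: Gx | apply: Gy].
Qed.

Lemma zsubmodule_zint : zsubmodule (zint : set K).
Proof.
apply/zsubmoduleP; split; first by exists 0.
by move=> _ _ [a _ <-] [b _ <-]; exists (a - b); rewrite // rmorphB.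
Qed.

Lemma zint_sub A : zsubmodule A -> A 1 -> zint `<=` A.
Proof. by move=> zA A1 _ [m _ <-]; apply: zsubmoduleMz. Qed.

Lemma zsubmodule_lmul A B : zsubmodule (A ** B).
Proof. exact: zsubmodule_smallest. Qed.

Lemma lmul_mem A B x y : A x -> B y -> (A ** B) (x * y).
Proof. by move=> Ax By; apply: (@sub_gen_smallest _ (@zsubmodule K)); exists x => //; exists y. Qed.

Lemma lmul_sub A B C : zsubmodule C ->
  (forall x y, A x -> B y -> C (x * y)) -> A ** B `<=` C.
Proof. by move=> zC ABC; apply: smallest_sub => // _ [x Ax [y By <-]]; apply: ABC. Qed.

Lemma lmulSS A B C D : A `<=` C -> B `<=` D -> A ** B `<=` C ** D.
Proof.
move=> AC BD; apply: lmul_sub; first exact: zsubmodule_lmul.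
by move=> x y Ax By; apply: lmul_mem; [apply: AC | apply: BD].
Qed.

Lemma lmulC A B : A ** B = B ** A.
Proof.
by apply/seteqP; split; apply: lmul_sub => [|x y Ax By];
  first [exact: zsubmodule_lmul | rewrite mulrC; exact: lmul_mem].
Qed.

Lemma lmulA_sub A B C : A ** B ** C `<=` A ** (B ** C).
Proof.
apply: lmul_sub; first exact: zsubmodule_lmul.
move=> x c ABx Cc; move: x ABx; apply: (@lmul_sub _ _ [set x | (A ** (B ** C)) (x * c)]).
  exact/zsubmodule_mulr_preim/zsubmodule_lmul.
by move=> a b Aa Bb /=; rewrite -mulrA; do 2![apply: lmul_mem => //].
Qed.

Lemma lmulA A B C : A ** (B ** C) = A ** B ** C.
Proof.
apply/seteqP; split; last exact: lmulA_sub.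
(* By commutativity the missing inclusion is the one already proved, for the factors in the order
   [C], [B], [A]. *)
by rewrite lmulC (lmulC B) [A ** B]lmulC [X in _ `<=` X]lmulC; apply: lmulA_sub.
Qed.

Lemma lmulCA A B C : A ** (B ** C) = B ** (A ** C).
Proof. by rewrite !lmulA (lmulC A). Qed.

Lemma zint_lmul A : zsubmodule A -> zint ** A = A.
Proof.
move=> zA; apply/seteqP; split.
  by apply: lmul_sub => // _ a [m _ <-] Aa; rewrite mulrzl; apply: zsubmoduleMz.
by move=> a Aa; rewrite -[a]mul1r; apply: lmul_mem => //; exists 1.
Qed.

Lemma lmul_scalel c A B : scale c A ** B = scale c (A ** B).
Proof.
apply/seteqP; split.
  apply: lmul_sub => [|_ b [a Aa <-] Bb]; first exact/zsubmodule_scale/zsubmodule_lmul.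
  by exists (a * b); [apply: lmul_mem | rewrite mulrA].
move=> _ [x ABx <-]; rewrite mulrC; move: x ABx.
apply: (@lmul_sub _ _ [set x | (scale c A ** B) (x * c)]) => [|a b Aa Bb /=].
  exact/zsubmodule_mulr_preim/zsubmodule_lmul.
by rewrite mulrC mulrA; apply: lmul_mem => //; exists a.
Qed.

Lemma scale_scale c d A : scale c (scale d A) = scale (c * d) A.
Proof.
apply/seteqP; split=> [_ [_ [a Aa <-] <-]|_ [a Aa <-]].
  by exists a; rewrite ?mulrA.
by exists (d * a); rewrite ?mulrA //; exists a.
Qed.

Lemma scale1 A : scale 1 A = A.
Proof.
by apply/seteqP; split=> [_ [a Aa <-]|a Aa]; [rewrite mul1r | exists a; rewrite ?mul1r].
Qed.

Lemma scaleVK c A : c != 0 -> scale c (scale c^-1 A) = A.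
Proof. by move=> c0; rewrite scale_scale divff // scale1. Qed.

Lemma scaleKV c A : c != 0 -> scale c^-1 (scale c A) = A.
Proof. by move=> c0; rewrite scale_scale mulVf // scale1. Qed.

Lemma scaleS c A B : A `<=` B -> scale c A `<=` scale c B.
Proof. by move=> AB _ [a /AB Ba <-]; exists a. Qed.

(** [iterop] treats exponents 0 and 1 separately; the recursion is uniform because Z is a unit for
    the product of submodules. *)
Lemma lpowS A r : zsubmodule A -> lpow A r.+1 = A ** lpow A r.
Proof.
by case: r => [|r] zA //; rewrite /lpow /= lmulC zint_lmul.
Qed.

Lemma zsubmodule_lpow A r : zsubmodule A -> zsubmodule (lpow A r).
Proof.
move=> zA; case: r => [|r]; first exact: zsubmodule_zint.
by rewrite lpowS //; apply: zsubmodule_lmul.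
Qed.

Lemma lpowD A (r s : nat) : zsubmodule A -> lpow A (r + s) = lpow A r ** lpow A s.
Proof.
move=> zA; elim: r => [|r IH]; first by rewrite zint_lmul //; apply: zsubmodule_lpow.
by rewrite addSn !lpowS // IH lmulA.
Qed.

Lemma lpow_mem A x r : zsubmodule A -> A x -> lpow A r (x ^+ r).
Proof.
move=> zA Ax; elim: r => [|r IH]; first by exists 1.
by rewrite exprS lpowS //; apply: lmul_mem.
Qed.

Lemma lpow_subr A (r s : nat) : zsubmodule A -> A 1 -> (r <= s)%N -> lpow A r `<=` lpow A s.
Proof.
move=> zA A1 /subnK <-; elim: (s - r)%N => [//|k IH] x /IH Ax.
by rewrite addSn lpowS // -[x]mul1r; apply: lmul_mem.
Qed.

(** Defined as a smallest submodule rather than by integer coefficients, so that inclusions reduce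
    to generators; [zspan_tupleE] identifies it with [inIntSpan]. *)
Definition zspan s : set K := smallest (@zsubmodule K) [set` s].

Lemma zspan_mem s x : x \in s -> zspan s x.
Proof. by move=> sx; apply: (@sub_gen_smallest _ (@zsubmodule K)). Qed.

Lemma zspan_sub s A : zsubmodule A -> (forall x, x \in s -> A x) -> zspan s `<=` A.
Proof. by move=> zA sA; apply: smallest_sub. Qed.

Lemma zspan_tupleE m (s : m.-tuple K) : zspan s = [set x | inIntSpan s x].
Proof.
apply/seteqP; split.
  apply: zspan_sub; last first.
    move=> _ /tnthP[i ->] /=; exists [ffun j => (j == i)%:R].
    rewrite (bigD1 i) //= ffunE eqxx big1 ?addr0 -?tnth_nth // => j /negPf ji.
    by rewrite ffunE ji mulr0z.
  apply/zsubmoduleP; split=> [|_ _ [a ->] [b ->]] /=.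
    by exists [ffun=> 0]; rewrite big1 // => i _; rewrite ffunE mulr0z.
  exists [ffun i => a i - b i]; rewrite -sumrB; apply: eq_bigr => i _.
  by rewrite ffunE mulrzBr.
move=> _ [a ->]; apply: (@zsubmodule_sum (zspan s)) => [|i _].
  exact: zsubmodule_smallest.
apply: (@zsubmoduleMz (zspan s)); first exact: zsubmodule_smallest.
by apply: zspan_mem; rewrite -tnth_nth mem_tnth.
Qed.

Lemma finitely_generatedP A : finitely_generated A <-> exists s, A = zspan s.
Proof.
split=> [[m [s ->]]|[s ->]]; first by exists s; rewrite zspan_tupleE.
by exists (size s), (in_tuple s); rewrite -zspan_tupleE.
Qed.

Lemma zsubmodule_fg A : finitely_generated A -> zsubmodule A.
Proof. by case/finitely_generatedP=> s ->; apply: zsubmodule_smallest. Qed.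

Lemma lmul_zspan s t : zspan s ** zspan t = zspan [seq x * y | x <- s, y <- t].
Proof.
apply/seteqP; split; last first.
  apply: zspan_sub => [|_ /allpairsP[[x y] [xs yt ->]]]; first exact: zsubmodule_lmul.
  by apply: lmul_mem; apply: zspan_mem.
set Z := zspan [seq _ | _ <- _, _ <- _]; have zZ : zsubmodule Z by apply: zsubmodule_smallest.
apply: (lmul_sub zZ) => x y sx ty; move: x sx.
apply: (@zspan_sub _ [set x | Z (x * y)]) => [|x xs /=]; first exact: zsubmodule_mulr_preim.
rewrite mulrC; move: y ty.
apply: (@zspan_sub _ [set y | Z (y * x)]) => [|y yt /=]; first exact: zsubmodule_mulr_preim.
by rewrite mulrC; apply: zspan_mem; apply: allpairs_f.
Qed.

Lemma finitely_generated_lmul A B :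
  finitely_generated A -> finitely_generated B -> finitely_generated (A ** B).
Proof.
move=> /finitely_generatedP[s ->] /finitely_generatedP[t ->].
by rewrite lmul_zspan; apply/finitely_generatedP; eexists.
Qed.

Lemma finitely_generated_scale c A : finitely_generated A -> finitely_generated (scale c A).
Proof.
move=> fA; have zA := zsubmodule_fg fA.
suff -> : scale c A = zspan [:: c] ** A.
  by apply: finitely_generated_lmul => //; apply/finitely_generatedP; eexists.
apply/seteqP; split=> [_ [a Aa <-]|].
  by apply: lmul_mem => //; apply: zspan_mem; apply: mem_head.
apply: lmul_sub => [|x y cx Ay]; first exact: zsubmodule_scale.
move: x cx; apply: (@zspan_sub _ [set x | scale c A (x * y)]).
  exact/zsubmodule_mulr_preim/zsubmodule_scale.
by move=> x; rewrite inE => /eqP-> /=; exists y.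
Qed.

End Lattices.

(** * Integral elements, subrings, and cancellation of invertible modules *)

Section IntegralElements.
Variable K : fieldExtType rat.
Implicit Types (A B C D O P R : set K) (x y c : K) (s t : seq K).

Lemma subring_closedP R :
  subring_closed [in R] <->
  [/\ zsubmodule R, R 1 & forall x y, R x -> R y -> R (x * y)].
Proof.
split=> [[R1 RB RM]|[zR R1 RM]].
  split; first by split; rewrite // -(subrr 1); apply: RB.
    by rewrite !in_setE in R1.
  by move=> x y Rx Ry; have := RM x y; rewrite !in_setE; apply.
split; first by rewrite in_setE.
  by case: zR.
by move=> x y; rewrite !in_setE; apply: RM.
Qed.

Lemma ring_of_integers_subring : subring_closed [in @ring_of_integers K].
Proof.
apply/subring_closedP; split.
- apply/zsubmoduleP; split=> [|x y]; first exact: integral0.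
  exact: integral_sub.
- exact: integral1.
- exact: integral_mul.
Qed.

Lemma subring_idem R : subring_closed [in R] -> R ** R = R.
Proof.
move=> /subring_closedP[zR R1 RM]; apply/seteqP; split; first exact: lmul_sub.
by move=> x Rx; rewrite -[x]mul1r; apply: lmul_mem.
Qed.

(* Multiplication by x on generators of R is an integer matrix having x as an
   eigenvalue, so x is a root of its characteristic polynomial. *)
Lemma fg_subring_integral R : subring_closed [in R] -> finitely_generated R ->
  R `<=` @ring_of_integers K.
Proof.
move=> /subring_closedP[zR R1 RM] [m [s defR]] x Rx.
have Rs (i : 'I_m) : R s`_i.
  rewrite defR -zspan_tupleE; by apply: zspan_mem; rewrite -tnth_nth mem_tnth.
have /choice[M xs] (i : 'I_m) : exists a : int ^ m, x * s`_i = \sum_(j < m) s`_j *~ a j.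
  have : R (x * s`_i) by apply: RM.
  by rewrite {1}defR.
pose A : 'M[int]_m := \matrix_(j, i) M i j.
exists (char_poly A); first exact: char_poly_monic.
rewrite -[map_poly _ _]/(map_poly (intr : {rmorphism int -> K}) _) map_char_poly.
rewrite -eigenvalue_root_char; apply/eigenvalueP; exists (\row_i s`_i).
  apply/rowP=> i; rewrite !mxE xs; apply: eq_bigr => j _.
  by rewrite !mxE mulrzr.
(* The eigenvector is nonzero: otherwise all generators vanish, and so would 1, which they span. *)
apply/eqP=> s0; move: R1; rewrite defR => -[a /eqP]; rewrite big1 ?oner_eq0 // => i _.
by have /rowP/(_ i) := s0; rewrite !mxE => ->; rewrite mul0rz.
Qed.

(** The ring Z[x], as values of integer polynomials so that division by a monic relation of [x] can
    be applied. *)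
Definition zadjoin x : set K :=
  [set (map_poly (intr : int -> K) q).[x] | q in [set: {poly int}]].

Lemma zadjoin_subring x : subring_closed [in zadjoin x].
Proof.
apply/subring_closedP; split.
- apply/zsubmoduleP; split; first by exists 0; rewrite // rmorph0 horner0.
  by move=> _ _ [p _ <-] [q _ <-]; exists (p - q); rewrite // rmorphB !hornerE.
- by exists 1; rewrite // rmorph1 hornerC.
- by move=> _ _ [p _ <-] [q _ <-]; exists (p * q); rewrite // rmorphM hornerM.
Qed.

Lemma zadjoin_mem x : zadjoin x x.
Proof. by exists 'X; rewrite // map_polyX hornerX. Qed.

(** Since [A] and [B] are idempotent, [A ** B] regroups as its own square. *)
Lemma lmul_subring A B : subring_closed [in A] -> subring_closed [in B] ->
  subring_closed [in A ** B].
Proof.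
move=> sA sB; have [zA A1 _] := (subring_closedP A).1 sA.
have [zB B1 _] := (subring_closedP B).1 sB.
apply/subring_closedP; split; first exact: zsubmodule_lmul.
  by rewrite -[1]mulr1; apply: lmul_mem.
move=> x y ABx ABy; rewrite -(subring_idem sA) -(subring_idem sB).
by rewrite -lmulA [A ** (B ** B)]lmulCA lmulA; apply: lmul_mem.
Qed.

Lemma zint_subring : subring_closed [in (zint : set K)].
Proof.
apply/subring_closedP; split; [exact: zsubmodule_zint | by exists 1 |].
by move=> _ _ [a _ <-] [b _ <-]; exists (a * b); rewrite // rmorphM.
Qed.

(** Modulo a monic relation [f] of [x], every polynomial in [x] becomes a combination of the
    [x ^+ i] with [i < size f]. These lie in [lpow A i], and the powers of [A] increase because 1 is
    in [A]. *)
Lemma zadjoin_sub_lpow A x : zsubmodule A -> A 1 -> A x -> @ring_of_integers K x ->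
  exists d, zadjoin x `<=` lpow A d.
Proof.
move=> zA A1 Ax [f f_monic /rootP fx0]; exists (size f) => _ [q _ <-].
rewrite (Pdiv.RingMonic.rdivp_eq f_monic q) rmorphD rmorphM hornerD hornerM fx0 mulr0 add0r.
have := Pdiv.CommonRing.ltn_rmodpN0 q (monic_neq0 f_monic).
set g := Pdiv.CommonRing.rmodp _ _ => /ltnW le_gf.
rewrite horner_coef; apply: zsubmodule_sum; first exact: zsubmodule_lpow.
move=> i _; rewrite coef_map /= mulrzl; apply: zsubmoduleMz; first exact: zsubmodule_lpow.
apply: (lpow_subr zA A1 _ (lpow_mem _ zA Ax)).
exact: leq_trans (ltnW (ltn_ord i)) (leq_trans (size_poly _ _) le_gf).
Qed.

(** [R] is the product of the rings Z[a] for [a] in [s], and the exponents of the powers of [A]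
    containing them add up. If [s] spans [A], all powers of [A] lie in [R], hence in [lpow A N]. *)
Lemma integral_subring_sub_lpow A s : zsubmodule A -> A 1 ->
  (forall x, x \in s -> A x) -> (forall x, x \in s -> @ring_of_integers K x) ->
  exists R N, [/\ subring_closed [in R], forall x, x \in s -> R x & R `<=` lpow A N].
Proof.
move=> zA A1; elim: s => [|a s IH] As Zs.
  by exists zint, 0; split=> //; apply: zint_subring.
have [x sx|x sx|R [N [sR Rs RA]]] := IH.
- by apply: As; rewrite inE sx orbT.
- by apply: Zs; rewrite inE sx orbT.
have [d aA] := zadjoin_sub_lpow zA A1 (As a (mem_head _ _)) (Zs a (mem_head _ _)).
have [_ R1 _] := (subring_closedP R).1 sR.
have [_ a1 _] := (subring_closedP _).1 (zadjoin_subring a).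
exists (zadjoin a ** R), (d + N)%N; split; first exact: lmul_subring (zadjoin_subring a) sR.
  move=> x; rewrite inE => /predU1P[->|/Rs Rx].
    by rewrite -{2}[a]mulr1; apply: lmul_mem => //; apply: zadjoin_mem.
  by rewrite -[x]mul1r; apply: lmul_mem.
by rewrite lpowD //; apply: lmulSS.
Qed.

(* Powers of a finitely generated module A of integral elements containing 1
   stabilise; invertibility of A over O then allows to cancel. *)
Lemma invertible_integral_sub A B O : subring_closed [in O] ->
  finitely_generated A -> A `<=` @ring_of_integers K -> A 1 -> zsubmodule B ->
  A ** B = O -> A `<=` O.
Proof.
move=> sO fA intA A1 zB AB; have zA := zsubmodule_fg fA.
have [s defA] := (finitely_generatedP A).1 fA.
have sA x : x \in s -> A x by rewrite defA; apply: zspan_mem.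
have [x /sA/intA //|R [N [sR Rs RA]]] := integral_subring_sub_lpow zA A1 sA.
have [zR R1 RM] := (subring_closedP R).1 sR.
have AR : A `<=` R by rewrite defA; apply: zspan_sub.
have ARn k : lpow A k `<=` R.
  elim: k => [|k IH]; first exact: zint_sub.
  by rewrite lpowS // -(subring_idem sR); apply: lmulSS.
(* The factor [O] makes this hold at [k = 0] too, where both powers are Z. *)
have cancel k : lpow A k ** (lpow B k ** O) = O.
  elim: k => [|k IH]; first by rewrite !zint_lmul //; have [] := (subring_closedP O).1 sO.
  rewrite !lpowS // -!lmulA [lpow A k ** _]lmulCA IH lmulA AB.
  exact: subring_idem.
have [_ O1 _] := (subring_closedP O).1 sO.
apply: (@subset_trans _ (A ** O)).
  by move=> a Aa; rewrite -[a]mulr1; apply: lmul_mem.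
(* With B' = [lpow B N ** O], this reads A O = A^(N+1) B', which lies in A^N B' = O because A^(N+1)
   lies in R and R in A^N. *)
rewrite -{1}(cancel N) lmulA -lpowS // -[X in _ `<=` X](cancel N).
by apply: lmulSS => //; apply: subset_trans (ARn _) RA.
Qed.

End IntegralElements.

(** * Ideals, and the prime ideals of Z_K above [p] *)

Section PrimeIdeals.
Variable K : fieldExtType rat.
Implicit Types (A B C D O P Q : set K) (x y c : K).

Lemma ideal_zsubmodule O A : is_ideal O A -> zsubmodule A. Proof. by case. Qed.

Lemma ideal_sub O A : is_ideal O A -> A `<=` O. Proof. by case. Qed.

Lemma idealM O A x a : is_ideal O A -> O x -> A a -> A (x * a).
Proof. by case=> _ _; apply. Qed.

Lemma lmul_stable O A B : (forall x b, O x -> B b -> B (x * b)) ->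
  forall x c, O x -> (A ** B) c -> (A ** B) (x * c).
Proof.
move=> OB x c Ox; rewrite mulrC; move: c.
apply: (@lmul_sub _ _ _ [set c | (A ** B) (c * x)]).
  exact/zsubmodule_mulr_preim/zsubmodule_lmul.
by move=> a b Aa Bb /=; rewrite -mulrA [b * x]mulrC; apply: lmul_mem => //; apply: OB.
Qed.

Lemma is_ideal_id O : subring_closed [in O] -> is_ideal O O.
Proof. by move=> /subring_closedP[zO _ OM]; split. Qed.

Lemma is_ideal_lmul O A B : subring_closed [in O] ->
  A `<=` O -> is_ideal O B -> is_ideal O (A ** B).
Proof.
move=> sO AO [_ BO BM]; split; first exact: zsubmodule_lmul.
  by rewrite -[X in _ `<=` X](subring_idem sO); apply: lmulSS.
by move=> x a; apply: (lmul_stable BM).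
Qed.

Lemma ideal1_eq O A : is_ideal O A -> A 1 -> A = O.
Proof.
move=> [_ AO AM] A1; apply/seteqP; split=> // x Ox.
by rewrite -[x]mulr1; apply: AM.
Qed.

Lemma prime_ideal_not1 O P : prime_ideal O P -> ~ P 1.
Proof. by case=> iP PO _ /(ideal1_eq iP). Qed.

Lemma prime_ideal_contract O R P : subring_closed [in O] -> O `<=` R ->
  prime_ideal R P -> prime_ideal O (O `&` P).
Proof.
move=> sO OR prP; have [[zP PR PM] _ Pp] := prP.
have [zO O1 OM] := (subring_closedP O).1 sO.
split.
- split; [|by move=> x []|].
    apply/zsubmoduleP; split=> [|x y [Ox Px] [Oy Py]].
      by split; apply: zsubmodule0.
    by split; apply: zsubmoduleB.
  by move=> x a Ox [Oa Pa]; split; [apply: OM | apply: PM => //; apply: OR].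
- move=> eqO; apply: (prime_ideal_not1 prP).
  by move: O1; rewrite -{1}eqO => -[].
- move=> x y Ox Oy [_ Pxy].
  by have [Px|Py] := Pp x y (OR x Ox) (OR y Oy) Pxy; [left | right].
Qed.

Lemma bigprod_is_ideal O (I : eqType) (s : seq I) (P : I -> set K) :
  subring_closed [in O] -> (forall i, is_ideal O (P i)) ->
  is_ideal O (\big[@lmul K/O]_(i <- s) P i).
Proof.
move=> sO iP; elim: s => [|i s IH]; rewrite ?big_nil ?big_cons.
  exact: is_ideal_id.
by apply: is_ideal_lmul => //; apply: ideal_sub.
Qed.

Lemma bigprod_sub O (I : eqType) (s : seq I) (P : I -> set K) i :
  subring_closed [in O] -> (forall i, is_ideal O (P i)) -> i \in s ->
  \big[@lmul K/O]_(i <- s) P i `<=` P i.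
Proof.
move=> sO iP; elim: s => [//|j s IH]; rewrite inE big_cons => /predU1P[->|/IH sub].
  apply: lmul_sub => [|x y Px sy]; first exact: ideal_zsubmodule (iP j).
  rewrite mulrC; apply: (idealM (iP j)) => //.
  exact: ideal_sub (bigprod_is_ideal s sO iP) _ sy.
apply: lmul_sub => [|x y Px sy]; first exact: ideal_zsubmodule (iP i).
by apply: (idealM (iP i)); [apply: ideal_sub (iP j) _ Px | apply: sub].
Qed.

(** Split [x] as [x * (1 - c) + c * x]: each summand is an element of [A] times an element of
    [B]. *)
Lemma comaximal_meet O A B c : is_ideal O A -> is_ideal O B -> A c -> B (1 - c) ->
  A `&` B `<=` A ** B.
Proof.
move=> iA iB Ac Bc x [Ax Bx]; rewrite -[x]mulr1 -(subrK c 1) mulrDr.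
apply: (@zsubmoduleD _ (A ** B)); first exact: zsubmodule_lmul.
  exact: lmul_mem.
by rewrite mulrC; apply: lmul_mem.
Qed.

(* Primes of Z_K above p are maximal: divide a monic relation f(y) in P by y as
   long as p divides its constant term. *)
Lemma prime_ideal_unit_mod P (p : nat) y : prime p ->
  prime_ideal (@ring_of_integers K) P -> P p%:R ->
  ring_of_integers y -> ~ P y -> exists2 t, ring_of_integers t & P (1 - t * y).
Proof.
move=> p_pr [iP _ Ppr] Pp intY nPy; have [f] := intY.
have zP := ideal_zsubmodule iP.
have [zZ Z1 ZM] := (subring_closedP _).1 (ring_of_integers_subring K).
have intH (q : {poly int}) : ring_of_integers (map_poly (intr : int -> K) q).[y].
  rewrite horner_coef; apply: zsubmodule_sum => // i _; rewrite coef_map /= mulrzl.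
  apply: zsubmoduleMz => //.
  by elim: (i : nat) => [//|k IH]; rewrite exprS; apply: ZM.
(* The relation is weakened from f(y) = 0 to f(y) in [P], which is what survives the passage to a
   polynomial of smaller degree. *)
move=> + /rootP f0; have {f0} : P (map_poly (intr : int -> K) f).[y].
  by rewrite f0; apply: zsubmodule0.
elim/poly_ind: f => [|g c IH] Pf mon_f; first by move: (monic_neq0 mon_f); rewrite eqxx.
move: Pf; rewrite rmorphD rmorphM /= map_polyX map_polyC /= !hornerE.
set gy := (map_poly _ g).[y] in IH * => Pf.
have [cop|] := boolP (coprimez p c).
  have [u [v uv]] := Bezoutz p c; move: cop; rewrite coprimezE => /eqP cop.
  (* From u p + v c = 1, this choice of t gives 1 - t y = u p + v f(y), where f(y) = g(y) y + c and
     [p] both lie in [P]. *)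
  exists (- (v%:~R * gy)).
    by apply: zsubmoduleN => //; rewrite mulrzl; apply: zsubmoduleMz => //; apply: intH.
  have -> : 1 - - (v%:~R * gy) * y = u%:~R * p%:R + v%:~R * (gy * y + c%:~R).
    have {1}-> : 1 = (u * p + v * c)%:~R :> K by rewrite uv /gcdz cop.
    by rewrite mulNr opprK rmorphD !rmorphM /= -addrA mulrDr mulrA [_ + v%:~R * gy * y]addrC.
  by rewrite !mulrzl; apply: zsubmoduleD => //; apply: zsubmoduleMz.
rewrite coprimezE prime_coprime // negbK => p_c.
have /dvdzP[k def_c] : (p %| c)%Z by [].
(* If [g] were 0, the monic polynomial f would be the constant 1, which [p] does not divide. *)
have g_neq0 : g != 0.
  apply: contraL p_c => /eqP g0; move: mon_f; rewrite g0 mul0r add0r monicE lead_coefC.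
  by move/eqP->; rewrite dvdn1; apply: contraTneq p_pr => /= ->.
have mon_g : g \is monic.
  move: mon_f; rewrite !monicE lead_coefDl ?lead_coefMX // size_mulX //.
  by rewrite ltnS (leq_trans (size_polyC_leq1 _)) // size_poly_gt0.
(* As [p] divides [c], the constant term lies in [P], hence so does g(y) y. Since [P] is prime and
   [y] is outside it, g(y) is in [P], and the induction continues with [g]. *)
suff Pgy : P (gy * y) by apply: IH => //; have [] := Ppr gy y (intH g) intY Pgy.
rewrite -(addrK (c%:~R) (gy * y)); apply: zsubmoduleB => //.
by rewrite def_c intrM mulrzl -pmulrn; apply: zsubmoduleMz.
Qed.

(** An element [y] of [P] outside [Q] is a unit modulo [Q], and [c] is the multiple t y congruent to
    1. Such a [y] exists: if [P] were inside [Q], an element of [Q] outside [P] would be a unit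
    modulo [P], forcing 1 into [Q]. *)
Lemma distinct_primes_comaximal P Q (p : nat) : prime p ->
  prime_ideal (@ring_of_integers K) P -> prime_ideal (@ring_of_integers K) Q ->
  P p%:R -> Q p%:R -> P <> Q -> exists2 c, P c & Q (1 - c).
Proof.
move=> p_pr prP prQ Pp Qp neqPQ; have [iP _ _] := prP; have [iQ _ _] := prQ.
have [y Py nQy] : exists2 y, P y & ~ Q y.
  apply: contrapT => noy.
  have PQ : P `<=` Q by move=> y Py; apply: contrapT => nQy; apply: noy; exists y.
  have [y Qy nPy] : exists2 y, Q y & ~ P y.
    apply: contrapT => noy'; apply: neqPQ; apply/seteqP; split=> // y Qy.
    by apply: contrapT => nPy; apply: noy'; exists y.
  have [t Zt Pt] := prime_ideal_unit_mod p_pr prP Pp (ideal_sub iQ Qy) nPy.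
  apply: (prime_ideal_not1 prQ); rewrite -(subrK (t * y) 1).
  apply: zsubmoduleD; [exact: ideal_zsubmodule iQ | exact: PQ |].
  exact: idealM iQ Zt Qy.
have [t Zt Qt] := prime_ideal_unit_mod p_pr prQ Qp (ideal_sub iP Py) nQy.
by exists (t * y) => //; apply: (idealM iP).
Qed.

(** Induction on [s]: the product over the tail is comaximal with the head prime, so an element of
    both lies in their product. *)
Lemma bigprod_primes (I : eqType) (s : seq I) (P : I -> set K) (p : nat) :
  prime p -> uniq s -> injective P ->
  (forall i, prime_ideal (@ring_of_integers K) (P i)) ->
  (forall i, i \in s -> P i p%:R) ->
  forall x, ring_of_integers x -> (forall i, i \in s -> P i x) ->
  (\big[@lmul K/@ring_of_integers K]_(i <- s) P i) x.
Proof.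
move=> p_pr + injP prP + x Zx.
have sZ := ring_of_integers_subring K; have [_ Z1 _] := (subring_closedP _).1 sZ.
have iP i : is_ideal (@ring_of_integers K) (P i) by have [] := prP i.
elim: s => [|i s IH] /=; first by rewrite big_nil.
case/andP=> nis us Pp Px; rewrite big_cons.
have iPs := bigprod_is_ideal s sZ iP.
have sPx : (\big[@lmul K/@ring_of_integers K]_(i <- s) P i) x.
  by apply: IH => // j js; [apply: Pp | apply: Px]; rewrite inE js orbT.
have [c Pc Pic] : exists2 c, (\big[@lmul K/@ring_of_integers K]_(i <- s) P i) c & P i (1 - c).
  elim: s nis {us IH iPs Px sPx} Pp => [|j s IH] nis Pp.
    exists 1; rewrite ?big_nil // subrr.
    exact: zsubmodule0 (ideal_zsubmodule (iP i)).
  move: nis; rewrite inE negb_or => /andP[/eqP neq_ij nis].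
  have [k|c sc Pic] := IH nis.
    rewrite inE => ks; apply: Pp; move: ks.
    by rewrite !inE => /orP[] ->; rewrite ?orbT.
  have Pjp : P j p%:R by apply: Pp; rewrite !inE eqxx orbT.
  have Pip : P i p%:R by apply: Pp; rewrite mem_head.
  have neqP : P j <> P i by move=> /injP eq_ji; apply: neq_ij.
  have [d Pd Pid] := distinct_primes_comaximal p_pr (prP j) (prP i) Pjp Pip neqP.
  exists (d * c); first by rewrite big_cons; apply: lmul_mem.
  (* Elements congruent to 1 modulo [P i], one from each other factor, multiply to an element of the
     product still congruent to 1. *)
  have -> : 1 - d * c = (1 - d) + d * (1 - c) by rewrite mulrBr mulr1 addrA subrK.
  apply: zsubmoduleD => //; first exact: ideal_zsubmodule (iP i).
  by apply: (idealM (iP i)) => //; apply: ideal_sub Pd.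
rewrite lmulC; apply: (comaximal_meet iPs (iP i) Pc Pic); split=> //.
by apply: Px; rewrite mem_head.
Qed.

Lemma p_radical_unramified (p : nat) O : prime p -> subring_closed [in O] ->
  O `<=` @ring_of_integers K -> unramified K p ->
  p_radical p O `<=` scale p%:R (@ring_of_integers K).
Proof.
move=> p_pr sO OZ [g [P [injP prP defp]]] x [Ox radx].
have sZ := ring_of_integers_subring K; have [_ Z1 _] := (subring_closedP _).1 sZ.
have iP i : is_ideal (@ring_of_integers K) (P i) by have [] := prP i.
(* [p] lies in p Z_K, which is the product of the [P i] and so is contained in each of them. *)
have Pp i : P i p%:R.
  apply: (bigprod_sub sZ iP (mem_index_enum i)); rewrite -defp.
  by exists 1; rewrite ?mulr1.
rewrite defp; apply: (bigprod_primes p_pr (index_enum_uniq _) injP prP) => //.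
  exact: OZ.
move=> i _; have [|//] := radx (O `&` P i).
split; first exact: prime_ideal_contract (prP i).
split=> //; have [zO O1 _] := (subring_closedP O).1 sO.
by rewrite pmulrn; apply: zsubmoduleMz.
Qed.

End PrimeIdeals.

(** * Full lattices, and the proof of the three claims *)

(** Multiplication by a nonzero [c] is an injective Q-linear endomorphism of [K], hence onto by
    dimension. *)
Lemma basis_of_mull (K : fieldExtType rat) (c : K) (b : seq K) : c != 0 ->
  basis_of {:K} b -> basis_of {:K} (map ( *%R c) b).
Proof.
move=> c0 bb; have kerc : ({:K} :&: lker (amull c))%VS = 0%VS.
  by rewrite (eqP (lker0_amull _)) ?unitfE // capv0.
have := limg_basis_of kerc bb; rewrite (eq_map (lfunE _)).
rewrite (_ : (amull c @: {:K})%VS = {:K}%VS) //.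
by apply/eqP; rewrite eqEdim subvf /= limg_dim_eq.
Qed.

(** Only a nonzero element of [A] is required, so that [A] may be Z; this occurs below as [lpow I 0]
    when [r = 1]. *)
Lemma full_lattice_lmul (K : fieldExtType rat) (A B : set K) (c : K) :
  finitely_generated A -> A c -> c != 0 -> full_lattice B -> full_lattice (A ** B).
Proof.
move=> fA Ac c0 [fB [b bb bB]]; split; first exact: finitely_generated_lmul.
exists (map ( *%R c) b); first exact: basis_of_mull.
by move=> _ /mapP[x xb ->]; apply: lmul_mem => //; apply: bB.
Qed.

Lemma finitely_generated_lpow (K : fieldExtType rat) (A : set K) r :
  finitely_generated A -> finitely_generated (lpow A r).
Proof.
move=> fA; elim: r => [|r IH].
  apply/finitely_generatedP; exists [:: 1]; apply/seteqP; split.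
    by apply: zint_sub; [apply: zsubmodule_smallest | apply: zspan_mem; apply: mem_head].
  apply: zspan_sub; first exact: zsubmodule_zint.
  by move=> x; rewrite inE => /eqP->; exists 1.
by rewrite lpowS; [apply: finitely_generated_lmul | apply: zsubmodule_fg].
Qed.

Theorem lemma4p4 (K : fieldExtType rat) (n : nat) (hn : \dim {:K} = n)
    (p : nat) (hp : prime p) (O I : set K)
    (hO : is_order O) (hI : full_lattice I)
    (ha : I p%:R)
    (hb : lpow I 2 `<=` I /\ I `<=` p_radical p O)
    (r : nat) (hr : (1 <= r < n)%N)
    (hc : invertible_ideal O (lpow I r))
    (hmin : forall s : nat, (1 <= s < r)%N -> ~ invertible_ideal O (lpow I s)) :
  [/\ invertible_ideal O (lmul I O),
      lmul (p_radical p O) (@ring_of_integers K)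
        = scale p%:R (@ring_of_integers K) ->
      [/\ I `<=` lmul I O, lmul I O = scale p%:R O
        & lpow I r = scale (p%:R ^+ r) O]
    & unramified K p ->
      lmul (p_radical p O) (@ring_of_integers K)
        = scale p%:R (@ring_of_integers K)].
Proof.
have [[fO _] sO] := hO; have [zO O1 OM] := (subring_closedP O).1 sO.
have [fI _] := hI; have zI := zsubmodule_fg fI.
have [_ IJ] := hb; have IO : I `<=` O by move=> x /IJ[].
have OZ := fg_subring_integral sO fO.
have sZ := ring_of_integers_subring K.
have [zZ Z1 _] := (subring_closedP _).1 sZ.
have p0 : p%:R != 0 :> K.
  by rewrite -(@scaler_nat rat K) scaler_eq0 oner_eq0 pnatr_eq0 orbF -lt0n prime_gt0.
have [iIr [B [lB BM] IrB]] := hc.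
(* The inverse of [I ** O]: regrouping, (I O) C = O (I^r B) = O O = O. *)
pose C := lpow I r.-1 ** B.
have ILC : I ** O ** C = O.
  rewrite /C -lmulA lmulCA [X in O ** X]lmulA -lpowS // prednK; last by case/andP: hr.
  by rewrite IrB subring_idem.
split.
- split; first exact: is_ideal_lmul (is_ideal_id sO).
  exists C => //; split; last by move=> x a; apply: (lmul_stable BM).
  (* Since [p] is in [I], its power p^(r-1) is a nonzero element of I^(r-1). *)
  apply: (@full_lattice_lmul _ _ _ (p%:R ^+ r.-1)) => //.
  + exact: finitely_generated_lpow.
  + exact: lpow_mem.
  + by rewrite expf_neq0.
- move=> JZ; have IOp : I ** O = scale p%:R O.
    apply/seteqP; split; last by move=> _ [x Ox <-]; apply: lmul_mem.
    rewrite -[I ** O](scaleVK _ p0); apply: scaleS.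
    (* Cancellation for p^-1 I O, with inverse p C. Integrality comes from I O being inside J Z_K =
       p Z_K, and 1 = p^-1 p is a member because [p] is in [I]. *)
    apply: (@invertible_integral_sub _ _ (scale p%:R C)) => //.
    + exact/finitely_generated_scale/finitely_generated_lmul.
    + rewrite -[X in _ `<=` X](scaleKV _ p0) -JZ; apply: scaleS.
      exact: lmulSS.
    + by exists p%:R; rewrite ?mulVf // -[p%:R]mulr1; apply: lmul_mem.
    + exact/zsubmodule_scale/zsubmodule_lmul.
    + rewrite lmul_scalel lmulC lmul_scalel scaleKV // lmulC.
      exact: ILC.
  split=> //; first by move=> x Ix; rewrite -[x]mulr1; apply: lmul_mem.
  have IkO k : lpow I k ** O = scale (p%:R ^+ k) O.
    elim: k => [|k IH]; first by rewrite zint_lmul // scale1.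
    rewrite lpowS // -lmulA IH lmulC lmul_scalel lmulC IOp.
    by rewrite scale_scale -exprSr.
  (* It remains to see that I^r absorbs [O], which holds because I^r is an ideal of [O]. *)
  rewrite -IkO; apply/seteqP; split.
    by move=> x Ix; rewrite -[x]mulr1; apply: lmul_mem.
  rewrite lmulC; apply: lmul_sub; first exact: ideal_zsubmodule iIr.
  by move=> x y Ox Iy; apply: (idealM iIr).
move=> unr; apply/seteqP; split.
  apply: (@subset_trans _ (scale p%:R (@ring_of_integers K) ** @ring_of_integers K)).
    by apply: lmulSS => //; apply: p_radical_unramified.
  by rewrite lmul_scalel subring_idem.
(* The converse inclusion uses that [p] lies in [I] and hence in the radical. *)
by move=> _ [x Zx <-]; apply: lmul_mem => //; apply: IJ.
Qed.
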